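(* For integers $r\geq s\geq 1$ let $B_{r,s}$ and $(p_k)_{k\geq 0}$ (depending on $r,s$) be as defined in the context. Then: (i) For all integers $r\geq s\geq 1$, the sequence $(p_k)_{k\ge 0}$ is increasing with limit $p_*\leq 1$, where $p_*=p_*(r,s)$ is the smallest positive root of $B_{r,s}(p)-2p+1=0$. (ii) There exists an integer-valued function $r(s)$ of the integer $s\geq 1$ such that, for all integers $r\geq s\geq 1$, $p_*(r,s)=1$ if and only if $r<r(s)$; this function satisfies $r(s)=2s+o(s)$ but also $r(s)=2s+\omega(\sqrt{s})$ as $s\to\infty$, that is, $r(s)/s\to 2$ and $(r(s)-2s)/\sqrt{s}\to\infty$. (iii) If $r\geq s\geq 2$ and $p_*(r,s)=1$, then $-\log(1-p_k)=\Omega(s^{k})$ as $k\to\infty$ (with $r,s$ fixed), i.e. there is a constant $c>0$ depending only on $r,s$ with $-\log(1-p_k)\geq c\,s^k$ for all sufficiently large $k$. (iv) The only other case with $r>1$ in which $p_*(r,s)=1$ is $r=2$, $s=1$ (that is, for $s=1$ and $r\geq 2$, $p_*(r,1)=1$ if and only if $r=2$), and in that case $1-p_k=(2+o(1))/\log k$ as $k\to\infty$.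
   Context: $B_{r,s}(p)$ denotes the probability that a binomial $\operatorname{Bin}(r,p)$ random variable takes a value greater than $r-s$, for $p\in[0,1]$; roots of $B_{r,s}(p)-2p+1=0$ are considered in $[0,1]$ (note that $p=1$ is always a root). For $x,p\in[0,1]$ and integers $k\geq 0$ let $$f_k(x,p)=(k+1)B_{r,s}(p)-kB_{r,s}(x)-2x+1 .$$ For every $p\in[0,1)$ there is a unique $x\in(0,1)$ with $f_k(x,p)=0$. The sequence $(p_k)_{k\geq 0}$ is defined by $p_0=0$ and, for each $k\geq 1$, $p_k$ is the unique value in $(0,1)$ with $f_k(p_k,p_{k-1})=0$. *)

(* Defs.v *)
From HB Require Import structures.
From mathcomp Require Import all_boot all_order all_algebra.
From mathcomp Require Import all_classical all_reals all_analysis.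
From mathcomp Require Import ring lra.

Set Implicit Arguments.
Unset Strict Implicit.
Unset Printing Implicit Defensive.

Import Order.TTheory GRing.Theory Num.Theory.
Import numFieldNormedType.Exports.

Local Open Scope classical_set_scope.
Local Open Scope ring_scope.

(* Only meaningful for 0 <= p <= 1 and s <= r: outside [0, 1] the measure
   [binomial_prob r p] is a Dirac mass, and r - s is truncated. *)
Definition binB {R : realType} (r s : nat) (p : R) : R :=
  fine (binomial_prob r p [set j : nat | (r - s < j)%N]).

Definition fk {R : realType} (r s k : nat) (x p : R) : R :=
  k.+1%:R * binB r s p - k%:R * binB r s x - 2 * x + 1.

(* The default value 0 of [xget] is never used: see [pseqP]. *)
Fixpoint pseq (R : realType) (r s k : nat) : R :=
  if k is k'.+1 then
    xget 0 [set x : R | 0 < x < 1 /\ fk r s k x (pseq R r s k') = 0]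
  else 0.

Definition is_smallest_positive_root {R : realType} (r s : nat) (p : R) : Prop :=
  [/\ 0 < p <= 1, binB r s p - 2 * p + 1 = 0 &
      forall q : R, 0 < q <= 1 -> binB r s q - 2 * q + 1 = 0 -> p <= q].

(* The default value 0 of [xget] is never used: see [pstarP]. *)
Definition pstar (R : realType) (r s : nat) : R :=
  xget 0 [set p : R | is_smallest_positive_root r s p].

Section well_defined.
Context {R : realType}.
Implicit Types (p q x : R) (r s m k : nat).

Let pmfE r p j :
  binomial_pmf r p j = p ^+ j * (1 - p) ^+ (r - j) *+ 'C(r, j).
Proof. by []. Qed.

Let tail r m p : R := \sum_(0 <= j < r.+1 | (m <= j)%N) binomial_pmf r p j.

Lemma binB_sum r s p : 0 <= p <= 1 ->
  binB r s p = \sum_(0 <= j < r.+1 | (r - s < j)%N) binomial_pmf r p j.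
Proof.
move=> /andP[p0 p1]; rewrite /binB (@binomial_probE _ r p p0 p1) big_mkord.
rewrite [X in fine X](_ : _ = (\sum_(j < r.+1 | (r - s < j)%N)
   binomial_pmf r p j)%:E) //.
rewrite -sumEFin [RHS]big_mkcond/=; apply: eq_bigr => i _.
rewrite diracE; case: ifPn => h.
  by rewrite mem_set//= mule1.
by rewrite memNset ?mule0//=; apply/negP.
Qed.

Let tailS r m p : tail r.+1 m.+1 p = (1 - p) * tail r m.+1 p + p * tail r m p.
Proof.
rewrite /tail [LHS]big_mkcond big_nat_recl//= add0r.
rewrite (eq_bigr (fun i => (if (m <= i)%N then
    p ^+ i.+1 * (1 - p) ^+ (r - i) *+ 'C(r, i.+1) else 0) +
    p * (if (m <= i)%N then binomial_pmf r p i else 0))); last first.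
  move=> i _; rewrite ltnS; case: ifP => _; last by rewrite mulr0 addr0.
  by rewrite pmfE subSS binS mulrnDr exprS mulrnAr mulrA.
rewrite big_split/= -mulr_sumr -big_mkcond/=; congr (_ + _); last first.
  by rewrite -big_mkcond.
rewrite big_mkcond big_nat_recr//= bin_small// mulr0n if_same addr0.
rewrite [in RHS]big_mkcond big_nat_recl//= add0r mulr_sumr.
apply: eq_big_nat => i /andP[_ ir]; rewrite ltnS; case: ifP => _; last by rewrite mulr0.
by rewrite pmfE -(subnSK ir) [(1 - p) ^+ _.+1]exprS mulrnAr; congr (_ *+ _); ring.
Qed.

Let tail0 r p : tail r 0 p = 1.
Proof.
rewrite /tail big_mkord -(expr1n _ r) -[X in _ = X ^+ _](subrK p 1) exprDn.
by apply: eq_bigr => i _; rewrite pmfE mulrC.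
Qed.

Let tail_le r m p q : 0 <= p -> p <= q -> q <= 1 -> tail r m p <= tail r m q.
Proof.
move=> p0 pq q1.
have tail_dec r' m' x : 0 <= x <= 1 -> tail r' m'.+1 x <= tail r' m' x.
  move=> x01; rewrite /tail [leLHS]big_mkcond [leRHS]big_mkcond.
  apply: ler_sum => i _; case: ifPn => [/ltnW ->//|_].
  by case: ifPn => // _; exact: binomial_pmf_ge0.
elim: r m => [|r IH] [|m]; rewrite ?tail0//.
  by rewrite /tail big_mkcond/= big_nat1 big_mkcond/= big_nat1.
rewrite !tailS; have := IH m; have := IH m.+1.
have := tail_dec r m q; rewrite (le_trans p0 pq) q1 => /(_ isT).
have := tail_dec r m p; rewrite p0 (le_trans pq q1) => /(_ isT).
set a := tail _ _ _; set b := tail _ _ _; set c := tail _ _ _; set d := tail _ _ _.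
move=> ab cd ac bd.
have h1 : (1 - p) * a <= (1 - p) * c by rewrite ler_wpM2l// subr_ge0 (le_trans pq).
have h2 : p * b <= p * d by rewrite ler_wpM2l.
have h3 : 0 <= (q - p) * (d - c) by rewrite mulr_ge0// subr_ge0.
lra.
Qed.

Lemma binB_le r s p q : 0 <= p -> p <= q -> q <= 1 -> binB r s p <= binB r s q.
Proof.
move=> p0 pq q1; rewrite !binB_sum ?(le_trans p0 pq)// ?p0 ?(le_trans pq q1)//.
exact: (@tail_le r (r - s).+1).
Qed.

Let poly_binB r s : exists P : {poly R},
  forall p, 0 <= p <= 1 -> binB r s p = P.[p].
Proof.
exists (\sum_(0 <= j < r.+1 | (r - s < j)%N)
  'X ^+ j * (1 - 'X) ^+ (r - j) *+ 'C(r, j)).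
move=> p p01; rewrite binB_sum// horner_sum; apply: eq_bigr => i _.
by rewrite hornerMn hornerM !horner_exp !hornerE.
Qed.

Lemma binB0 r s : (s <= r)%N -> binB r s (0 : R) = 0.
Proof.
move=> sr; rewrite binB_sum ?lexx ?ler01//; apply: big1 => i ri.
by rewrite pmfE expr0n gtn_eqF ?(leq_ltn_trans _ ri)// mul0r mul0rn.
Qed.

Lemma binB1 r s : (1 <= s <= r)%N -> binB r s (1 : R) = 1.
Proof.
move=> /andP[s1 sr]; rewrite binB_sum ?lexx ?ler01//.
rewrite big_mkcond big_nat_recr//= big_nat big1 => [|i /andP[_ ir]].
  rewrite add0r ltn_subrL s1 (leq_trans s1 sr) pmfE.
  by rewrite binn subnn expr0 expr1n mulr1.
case: ifP => // _; rewrite pmfE subrr expr0n subn_eq0 leqNgt ir.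
by rewrite mulr0 mul0rn.
Qed.

Lemma binB_lt1 r s p : (1 <= s <= r)%N -> 0 <= p < 1 -> binB r s p < 1.
Proof.
move=> /andP[s1 sr] /andP[p0 p1].
have p01 : 0 <= p <= 1 by rewrite p0 ltW.
rewrite binB_sum// -[ltRHS](tail0 r p) /tail [in ltRHS](bigID (fun j => (r - s < j)%N))/=.
rewrite ltrDl.
have [->|pn0] := eqVneq p 0; last first.
  rewrite big_mkcond big_nat_recl//= ltr_pwDl//.
    by rewrite pmfE expr0 mul1r bin0 mulr1n exprn_gt0// subr_gt0.
  by apply: sumr_ge0 => i _; case: ifP => // _; exact: binomial_pmf_ge0.
rewrite big_mkcond big_nat_recl//= ltr_pwDl//.
  by rewrite pmfE expr0 mul1r bin0 mulr1n subr0 expr1n.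
by apply: sumr_ge0 => i _; case: ifP => // _; rewrite binomial_pmf_ge0// lexx ler01.
Qed.

Lemma fk_root_unique r s k p : (1 <= s <= r)%N -> 0 <= p < 1 ->
  exists! x : R, 0 < x < 1 /\ fk r s k x p = 0.
Proof.
move=> sr p01; have /andP[p0 p1] := p01; have [P PE] := poly_binB r s.
have B0 : binB r s (0 : R) = 0 by apply: binB0; case/andP: sr.
have B1 := binB1 sr; have Bp := binB_lt1 sr p01.
have Bp0 : 0 <= binB r s p by rewrite -B0 binB_le// ltW.
have I0 : 0 <= (0 : R) <= 1 by rewrite lexx ler01.
have I1 : 0 <= (1 : R) <= 1 by rewrite lexx ler01.
pose Q := (k.+1%:R * binB r s p + 1)%:P - k%:R *: P - 2 *: 'X.
have QE x : 0 <= x <= 1 -> fk r s k x p = Q.[x].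
  by move=> x01; rewrite /fk (PE x x01) /Q !hornerE/=; ring.
have k0 : 0 <= k%:R :> R by [].
have f0 : 0 < fk r s k 0 p.
  by rewrite /fk B0 !mulr0 !subr0 ltr_wpDl// mulr_ge0.
have f1 : fk r s k 1 p < 0.
  rewrite /fk B1 -natr1.
  have : 0 < (k%:R + 1) * (1 - binB r s p) by rewrite mulr_gt0// ?subr_gt0// ltr_wpDl.
  lra.
have [x /itvP x01 fx] : exists2 x, x \in `[0, 1] & root (- Q) x.
  by apply: poly_ivt => //; rewrite !hornerN -!QE// oppr_le0 oppr_ge0 !ltW.
have x01' : 0 <= x <= 1 by rewrite !x01.
move: fx; rewrite rootE hornerN oppr_eq0 -QE// => /eqP fx.
exists x; split; first split => //.
  rewrite !lt_neqAle !x01 !andbT; apply/andP; split; apply/eqP => xE.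
    by move: fx f0; rewrite -xE => ->; rewrite ltxx.
  by move: fx f1; rewrite xE => ->; rewrite ltxx.
move=> y [/andP[y0 y1]] fy.
have key (u v : R) : 0 <= u -> v <= 1 -> u < v -> fk r s k v p < fk r s k u p.
  move=> u0 v1 uv; rewrite /fk.
  have : k%:R * binB r s u <= k%:R * binB r s v.
    by rewrite ler_wpM2l// binB_le// ltW.
  lra.
have [xy|xy|//] := ltgtP x y.
  by have := key x y; rewrite !x01 (ltW y1) fx fy ltxx => /(_ isT isT xy).
by have := key y x; rewrite !x01 (ltW y0) fx fy ltxx => /(_ isT isT xy).
Qed.

Lemma pseqP r s k : (1 <= s <= r)%N ->
  0 < pseq R r s k.+1 < 1 /\ fk r s k.+1 (pseq R r s k.+1) (pseq R r s k) = 0.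
Proof.
move=> sr.
have step j : 0 <= pseq R r s j < 1 -> 0 < pseq R r s j.+1 < 1 /\
    fk r s j.+1 (pseq R r s j.+1) (pseq R r s j) = 0.
  move=> /(fk_root_unique j.+1 sr)[x [fx _]].
  exact: (@xgetI _ (0 : R)
    [set y : R | 0 < y < 1 /\ fk r s j.+1 y (pseq R r s j) = 0] x fx).
suff p01 : 0 <= pseq R r s k < 1 by exact: step.
elim: k => [|k /step[/andP[/ltW -> ->]//]].
by rewrite /= lexx ltr01.
Qed.

Lemma pstarP r s : (1 <= s <= r)%N -> is_smallest_positive_root r s (pstar R r s).
Proof.
move=> sr; apply: xgetPex => /=; have [P PE] := poly_binB r s.
pose Q := P - 2 *: 'X + 1.
have QE x : 0 <= x <= 1 -> binB r s x - 2 * x + 1 = Q.[x].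
  by move=> x01; rewrite PE// /Q !hornerE.
have Q0 : Q != 0.
  apply/eqP => Q0; have := QE 0; rewrite lexx ler01 => /(_ isT).
  rewrite Q0 horner0 binB0; last by case/andP: sr.
  by rewrite mulr0 subr0 add0r => /eqP; rewrite oner_eq0.
have r1 : binB r s (1 : R) - 2 * 1 + 1 = 0 by rewrite (binB1 sr); ring.
have [m nS] : exists n, forall l : seq R, uniq l -> all (root Q) l -> (size l < n)%N.
  by exists (size Q) => l ul rl; exact: max_poly_roots.
pose S := [set q : R | 0 < q <= 1 /\ binB r s q - 2 * q + 1 = 0].
apply: contrapT => nomin.
have step (n : nat) : exists l : seq R,
    [/\ size l = n.+1, sorted <%R l & forall q, q \in l -> S q].
  elim: n => [|n [l0 [sl sol inl]]].
    by exists [:: 1]; split => // q; rewrite inE => /eqP ->; rewrite /S/= ltr01 lexx.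
  case: l0 sl sol inl => [//|a l] sl sol inl.
  have [a01 fa] := inl a (mem_head _ _).
  have [b [b01 fb ba]] : exists b, [/\ 0 < b <= 1, binB r s b - 2 * b + 1 = 0 & b < a].
    apply: contrapT => nob; apply: nomin; exists a; split => // q q01 fq.
    by rewrite leNgt; apply/negP => qa; apply: nob; exists q.
  exists [:: b, a & l]; split => //=; first by move: sl => /= ->.
    by rewrite ba.
  by move=> q; rewrite inE => /orP[/eqP ->//|]; exact: inl.
have [l [sl sol inl]] := step m.
suff rl : all (root Q) l.
  by have := nS l (sorted_uniq lt_trans ltxx sol) rl; rewrite sl ltnNge leqnSn.
apply/allP => q /inl[/andP[q0 q1] fq].
by rewrite rootE -QE ?fq// q1 ltW.
Qed.

End well_defined.

(* Main.v *)
Require Import Defs.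
From mathcomp Require Import all_boot all_order all_algebra.
From mathcomp Require Import all_classical all_reals all_analysis.
From mathcomp Require Import ring lra.

Import Order.TTheory GRing.Theory Num.Theory.
Import numFieldNormedType.Exports.

Local Open Scope classical_set_scope.
Local Open Scope ring_scope.

(** Counting failures with [q = 1 - p], let [T(q)] be the probability that at
least [s] out of [r] independent events of probability [q] occur. The equation
for [pstar] becomes [T(q) = 2 * q], and the recurrence becomes
[(k+1) * T(q_(k+1)) + 2 * q_(k+1) = (k+2) * T(q_k)].

Monotone convergence. [T] is strictly increasing, and [T(q) < 2 * q] to the
right of the root [1 - pstar]. Comparing the two sides of the recurrence shows
that [q_k] decreases and stays above this root ([qseq_decr],
[qseq_gt_pstar]). Its limit [l] satisfies [T(l) >= 2 * l]
([qseq_lb_utail]), because otherwise [2 * l - T(q_k)] would grow linearly; so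
the limit is the root.

The threshold. [pstar = 1] means that the curve [T] lies strictly below the line
[2 * q] on the open interval ([pstar_eq1P]). As [T] increases with [r], this
holds exactly below some threshold in [r]. If [r] exceeds [2 * s] by a positive
proportion, then [T] is nearly 1 at some fixed [q < 1/2] and crosses the line
([threshold_upper]). If [r] exceeds [2 * s] by only [C * sqrt s], Chebyshev's
inequality gives [T(q) <= q] when [q] is at least a large multiple of
[1 / sqrt s] below 1/2, and closer to 1/2 the line is nearly at height 1, while
[T(1/2)] stays below 1 by a constant depending on [C] ([pstar_eq1_near]). The
latter comes from comparing the laws with parameters 1/2 and
[1/2 - O(1 / sqrt r)] through the second moment of their likelihood ratio
([ltail_half_ge]).

Rates when [pstar = 1]. For [s >= 2], [T(q) = O(q^s)] is eventually negligible
with respect to [q]; this first forces polynomial decay of [q_k]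
([qseq_quadratic_decay]), after which [q_(k+1) = O(k * q_k^s)] takes over and
gives doubly exponential decay ([qseq_superexp]). For [s = 1] and [r = 2],
[T(q) = 2 * q - q^2] and the recurrence reduces to
[(k+2) * (2 - x - y) * (x - y) = y^2] with [x = q_k] and [y = q_(k+1)]; hence
[1 / q_(k+1) - 1 / q_k] is asymptotic to [1 / (2 * k)], and the Stolz-Cesaro
theorem gives [1 / q_k] asymptotic to [ln k / 2]. *)

(** * Tails of the binomial law *)

Section binomial_expectation.
Context {R : realType}.
Implicit Types (q c d x M p : R) (r s j : nat) (g h : nat -> R).

(** The mean of [h] under the binomial law [Bin(r, q)]. Working with arbitrary
[h] lets the one conditioning identity [binES] serve for tails and for variance. *)
Definition binE r q h : R := \sum_(j < r.+1) binomial_pmf r q j * h j.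

Lemma binomial_pmfE r q j :
  binomial_pmf r q j = q ^+ j * (1 - q) ^+ (r - j) *+ 'C(r, j).
Proof. by []. Qed.

Lemma binE0 q h : binE 0 q h = h 0.
Proof.
by rewrite /binE big_ord1 binomial_pmfE subnn !expr0 mulr1 bin0 mulr1n mul1r.
Qed.

(** Conditioning on the outcome of one trial. *)
Lemma binES r q h :
  binE r.+1 q h = (1 - q) * binE r q h + q * binE r q (h \o S).
Proof.
rewrite /binE; have -> : \sum_(j < r.+1) binomial_pmf r q j * h j =
    \sum_(j < r.+2) binomial_pmf r q j * h j.
  rewrite [RHS]big_ord_recr /= binomial_pmfE bin_small // mulr0n mul0r.
  by rewrite addr0.
rewrite big_ord_recl [in RHS]big_ord_recl mulrDr -addrA; congr (_ + _).
  by rewrite !binomial_pmfE /= !bin0 !mulr1n !subn0 exprS; ring.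
rewrite !mulr_sumr -big_split /=; apply: eq_bigr => i _.
rewrite /bump /= add1n !binomial_pmfE subSS binS.
have [ir|ir] := ltnP i r.
  rewrite -(subnSK ir) (exprS _ (r - i.+1)) (exprS q i) mulrnDr mulrDl.
  by rewrite !mulrnAl !mulrnAr; congr (_ *+ _ + _ *+ _); ring.
rewrite [in 'C(r, i.+1)]bin_small // add0n mulr0n mul0r mulr0 add0r exprS.
by rewrite !mulrnAl !mulrnAr; congr (_ *+ _); ring.
Qed.

Lemma eq_binE r q g h : g =1 h -> binE r q g = binE r q h.
Proof. by move=> gh; apply: eq_bigr => i _; rewrite gh. Qed.

Lemma binED r q g h :
  binE r q (fun j => g j + h j) = binE r q g + binE r q h.
Proof. by rewrite -big_split; apply: eq_bigr => i _; rewrite mulrDr. Qed.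

Lemma binEZ r q c h : binE r q (fun j => c * h j) = c * binE r q h.
Proof. by rewrite mulr_sumr; apply: eq_bigr => i _; rewrite mulrCA. Qed.

Lemma binE1 r q : binE r q (fun=> 1) = 1.
Proof.
elim: r => [|r IH]; first by rewrite binE0.
by rewrite binES (@eq_binE _ _ (_ \o S) (fun=> 1)) // IH !mulr1 subrK.
Qed.

Lemma le_binE r q g h : 0 <= q <= 1 -> (forall j, g j <= h j) ->
  binE r q g <= binE r q h.
Proof.
move=> q01 gh; apply: ler_sum => i _; rewrite ler_wpM2l //.
exact: binomial_pmf_ge0.
Qed.

(** Shifting the centre [c] makes the identity stable under conditioning on
one trial, so that it follows by induction on the number of trials. *)
Lemma binE_sqr_dist r q c : binE r q (fun j => (j%:R - c) ^+ 2) =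
  r%:R * q * (1 - q) + (r%:R * q - c) ^+ 2.
Proof.
elim: r c => [|r IH] c; first by rewrite binE0; ring.
rewrite binES IH (@eq_binE _ _ _ (fun j => (j%:R - (c - 1)) ^+ 2)).
  by rewrite IH -natr1; ring.
by move=> j /=; rewrite -natr1; congr (_ ^+ 2); ring.
Qed.

Definition utail r s q : R := binE r q (fun j => (s <= j)%N%:R).

Lemma utail0 r q : utail r 0 q = 1.
Proof. exact: binE1. Qed.

Lemma utail0S s q : utail 0 s.+1 q = 0.
Proof. by rewrite /utail binE0. Qed.

Lemma utailSS r s q :
  utail r.+1 s.+1 q = (1 - q) * utail r s.+1 q + q * utail r s q.
Proof. exact: binES. Qed.

Lemma utail_ge0 r s q : 0 <= q <= 1 -> 0 <= utail r s q.
Proof.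
move=> q01; apply: sumr_ge0 => i _; apply: mulr_ge0 => //.
exact: binomial_pmf_ge0.
Qed.

Lemma utail_le1 r s q : 0 <= q <= 1 -> utail r s q <= 1.
Proof.
by move=> q01; rewrite -(binE1 r q) le_binE // => j; case: (s <= j)%N.
Qed.

Lemma utail_at1 r s : (s <= r)%N -> utail r s 1 = 1.
Proof.
elim: r s => [|r IH] [|s] //; rewrite ?utail0 // => sr.
by rewrite utailSS subrr mul0r add0r mul1r IH.
Qed.

Lemma utail_gtS r s q : (s <= r)%N -> 0 < q < 1 ->
  utail r s.+1 q < utail r s q.
Proof.
move=> sr q01; have [q0 q1] := andP q01.
elim: r s sr => [|r IH] [|s] //.
- by rewrite utail0S utail0 ltr01.
- move=> _; have := IH 0%N isT; rewrite utailSS !utail0 => h.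
  have : 0 < (1 - q) * (1 - utail r 1 q) by rewrite mulr_gt0 // subr_gt0.
  lra.
- move=> sr; rewrite !utailSS.
  have h1 : utail r s.+2 q <= utail r s.+1 q.
    apply: le_binE; first by rewrite !ltW.
    by move=> j; rewrite ler_nat; case: (ltnP s.+1 j) => [/ltnW ->|].
  have h2 := IH s sr.
  by rewrite ler_ltD // ?ltr_pM2l // ler_wpM2l // subr_ge0 ltW.
Qed.

Lemma utail_leS r s q : 0 <= q <= 1 -> utail r s q <= utail r.+1 s q.
Proof.
move=> q01; case: s => [|s]; first by rewrite !utail0.
rewrite utailSS -subr_ge0.
have : utail r s.+1 q <= utail r s q.
  apply: le_binE => // j.
  by rewrite ler_nat; case: (ltnP s j) => [/ltnW ->|].
have /andP[q0 _] := q01; rewrite -(subr_ge0 (utail r s.+1 q)) => /(mulr_ge0 q0).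
lra.
Qed.

Lemma utail_le r1 r2 s q : 0 <= q <= 1 -> (r1 <= r2)%N ->
  utail r1 s q <= utail r2 s q.
Proof.
move=> q01 /subnK <-; elim: (r2 - r1)%N => // n IH.
exact: (le_trans IH (utail_leS _ _ _ q01)).
Qed.

Lemma utail_le_pow r s q : 0 <= q <= 1 -> utail r s q <= 2 ^+ r * q ^+ s.
Proof.
move=> q01; have /andP[q0 q1] := q01.
elim: r s => [|r IH] [|s].
- by rewrite utail0 !expr0 mulr1.
- by rewrite utail0S mulr_ge0 ?exprn_ge0.
- by rewrite utail0 expr0 mulr1 exprn_ege1 // ler1n.
- rewrite utailSS (le_trans (_ : _ <= utail r s.+1 q + q * utail r s q)) //.
    rewrite lerD2r ler_piMl ?utail_ge0 //; lra.
  have := IH s.+1; have := ler_wpM2l q0 (IH s); rewrite !exprS.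
  lra.
Qed.

Lemma utail_mono r s q1 q2 : 0 <= q1 -> q1 <= q2 -> q2 <= 1 ->
  utail r s q1 <= utail r s q2.
Proof.
move=> q10 q12 q21.
have q01 : 0 <= q2 <= 1 by rewrite q21 (le_trans q10).
elim: r s => [|r IH] [|s]; rewrite ?utail0 ?utail0S // !utailSS.
have h1 := ler_wpM2l q10 (IH s).
have h2 : 0 <= (1 - q1) * (utail r s.+1 q2 - utail r s.+1 q1).
  by rewrite mulr_ge0 // subr_ge0 // (le_trans q12).
have h3 : 0 <= (q2 - q1) * (utail r s q2 - utail r s.+1 q2).
  rewrite mulr_ge0 // subr_ge0 // le_binE // => j.
  by rewrite ler_nat; case: (ltnP s j) => [/ltnW ->|].
lra.
Qed.

(** The derivative of [utail r.+1 s.+1] is [r.+1] times the point mass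
[utail r s q - utail r s.+1 q], which is positive inside the interval; here this
mass appears as the factor of [q2 - q1] after one conditioning step. *)
Lemma utail_strict_mono r s q1 q2 : (0 < s <= r)%N ->
  0 <= q1 -> q1 < q2 -> q2 < 1 -> utail r s q1 < utail r s q2.
Proof.
move=> sr q10 q12 q21.
have q01 : 0 < q2 < 1 by rewrite q21 (le_lt_trans q10).
case: r s sr => [|r] [|s] // sr; rewrite !utailSS.
have h1 := ler_wpM2l q10 (utail_mono r s _ _ q10 (ltW q12) (ltW q21)).
have h2 : 0 <= (1 - q1) * (utail r s.+1 q2 - utail r s.+1 q1).
  rewrite mulr_ge0 ?subr_ge0 ?utail_mono ?(ltW q12) ?(ltW q21) //.
  by rewrite (le_trans (ltW q12)) ?ltW.
have h3 : 0 < (q2 - q1) * (utail r s q2 - utail r s.+1 q2).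
  by rewrite mulr_gt0 // subr_gt0 // utail_gtS.
lra.
Qed.

Lemma continuous_utail r s : continuous (utail r s).
Proof.
elim: r s => [|r IH] [|s].
- by rewrite (_ : utail 0 0 = cst 1) ?funeqE => x; [exact: cvg_cst|exact: utail0].
- by rewrite (_ : utail 0 s.+1 = cst 0) ?funeqE => x; [exact: cvg_cst|exact: utail0S].
- by rewrite (_ : utail r.+1 0 = cst 1) ?funeqE => x; [exact: cvg_cst|exact: utail0].
- rewrite (_ : utail r.+1 s.+1 =
      fun q => (1 - q) * utail r s.+1 q + q * utail r s q).
    move=> x; apply: cvgD; apply: cvgM; try exact: IH; last exact: cvg_id.
    by apply: cvgB; [exact: cvg_cst|exact: cvg_id].
  by rewrite funeqE => q; exact: utailSS.
Qed.

(** More than [r - s] successes means fewer than [s] failures; counting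
failures, of probability [1 - p], turns the defining equations into relations
between [utail] and a linear function. *)
Lemma binB_utail r s p : (s <= r)%N -> 0 <= p <= 1 ->
  binB r s p = 1 - utail r s (1 - p).
Proof.
move=> sr p01; apply/eqP; rewrite eq_sym subr_eq; apply/eqP.
rewrite binB_sum // big_mkord (reindex_inj rev_ord_inj) /= big_mkcond /=.
rewrite -[LHS](binE1 r (1 - p)) -big_split; apply: eq_bigr => i _ /=.
have ir : (i <= r)%N by rewrite -ltnS.
have -> : binomial_pmf r p (r.+1 - i.+1) = binomial_pmf r (1 - p) i.
  rewrite subSS !binomial_pmfE subKn // bin_sub //; congr (_ *+ _).
  by rewrite mulrC; congr (_ * _ ^+ _); ring.
have -> : (r - s < r.+1 - i.+1)%N = ~~ (s <= i)%N.
  by rewrite subSS ltn_sub2lE // -ltnNge.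
by case: (s <= i)%N; rewrite /= ?mulr1 ?mulr0 ?addr0 ?add0r.
Qed.

Lemma utailN r s q : 1 - utail r s q = binE r q (fun j => (j < s)%N%:R).
Proof.
apply/eqP; rewrite subr_eq -binED -[X in X == _](binE1 r q); apply/eqP.
by apply: eq_binE => j; rewrite ltnNge; case: (s <= j)%N; rewrite ?addr0 ?add0r.
Qed.

(** Chebyshev's inequality for the upper tail. The variance keeps its factor
[q], so that the bound is a multiple of [q] down to [q = 0]. *)
Lemma utail_chebyshev r s q : 0 <= q <= 1 -> r%:R * q < s%:R ->
  utail r s q * (s%:R - r%:R * q) ^+ 2 <= r%:R * q * (1 - q).
Proof.
move=> q01 qs; have := binE_sqr_dist r q (r%:R * q).
rewrite subrr expr0n addr0 => <-; rewrite mulrC -binEZ; apply: le_binE => // j.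
have [sj|] := leqP s j; last by rewrite mulr0 sqr_ge0.
rewrite mulr1 lerXn2r ?nnegrE ?subr_ge0 ?(ltW qs) //.
  by rewrite (le_trans (ltW qs)) // ler_nat.
by rewrite lerD2r ler_nat.
Qed.

Lemma ltail_chebyshev r s q : 0 <= q <= 1 -> s%:R < r%:R * q ->
  (1 - utail r s q) * (r%:R * q - s%:R) ^+ 2 <= r%:R * q * (1 - q).
Proof.
move=> q01 qs; have := binE_sqr_dist r q (r%:R * q).
rewrite subrr expr0n addr0 => <-.
rewrite utailN mulrC -binEZ; apply: le_binE => // j.
have [sj|] := ltnP j s; last by rewrite mulr0 sqr_ge0.
rewrite mulr1 -[leRHS]sqrrN opprB lerXn2r ?nnegrE ?subr_ge0 ?(ltW qs) //.
  by rewrite (le_trans _ (ltW qs)) // ler_nat ltnW.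
by rewrite lerD2l lerN2 ler_nat ltnW.
Qed.

(** The likelihood ratio between success probabilities [1/2 - d] and [1/2]. *)
Definition tilt r d j : R := (1 - 2 * d) ^+ j * (1 + 2 * d) ^+ (r - j).

Lemma binomial_pmf_tilt r d j : (j <= r)%N ->
  binomial_pmf r (2^-1 - d) j = binomial_pmf r 2^-1 j * tilt r d j.
Proof.
move=> jr; rewrite !binomial_pmfE mulrnAl /tilt mulrACA -!exprMn.
by congr (_ ^+ _ * _ ^+ _ *+ _); lra.
Qed.

(** The second moment of the likelihood ratio tensorizes over the trials. At
distance [d] of order [1 / sqrt r] it is bounded, so the two laws cannot
concentrate on disjoint events. *)
Lemma binE_sqr_tilt r d :
  binE r 2^-1 (fun j => tilt r d j ^+ 2) = (1 + 4 * d ^+ 2) ^+ r.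
Proof.
rewrite (_ : 1 + 4 * d ^+ 2 =
    2^-1 * (1 + 2 * d) ^+ 2 + 2^-1 * (1 - 2 * d) ^+ 2); last by lra.
rewrite exprDn; apply: eq_bigr => j _; rewrite binomial_pmfE mulrnAl.
congr (_ *+ _); rewrite /tilt (_ : 1 - 2^-1 = 2^-1 :> R); last by lra.
rewrite !exprMn.
move: (_ ^+ j) (_ ^+ (r - j)) ((1 - _) ^+ j) ((1 + 2 * d) ^+ (r - j)).
by move=> a' b' a b; ring.
Qed.

(** The inequality of arithmetic and geometric means for [M] and
[x ^+ 2 / (4 * M)]. *)
Lemma le_add_sqr_divr M x : 0 < M -> x <= M + (4 * M)^-1 * x ^+ 2.
Proof.
move=> M0; rewrite -subr_ge0.
have -> : M + (4 * M)^-1 * x ^+ 2 - x = (4 * M)^-1 * (x - 2 * M) ^+ 2.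
  by field; rewrite gt_eqF.
by rewrite mulr_ge0 ?sqr_ge0 // invr_ge0 mulr_ge0 // ltW.
Qed.

(** A lower tail of constant probability under [Bin(r, 1/2 - d)] keeps a
probability of order [(1 + 4 d^2)^-r] under [Bin(r, 1/2)]: this replaces the
central limit theorem for an event a bounded number of standard deviations away
from the mean. It is Cauchy-Schwarz against the likelihood ratio, in the additive
form given by [le_add_sqr_divr]. *)
Lemma ltail_half_ge r s d : 0 <= d <= 2^-1 ->
  1 - utail r s (2^-1 - d) <=
    (1 + 4 * d ^+ 2) ^+ r * (1 - utail r s 2^-1) + 4^-1.
Proof.
move=> /andP[d0 d1].
have pos : 0 < (1 + 4 * d ^+ 2) ^+ r.
  by rewrite exprn_gt0 // ltr_pwDl // mulr_ge0 // sqr_ge0.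
move: pos (binE_sqr_tilt r d); move: (_ ^+ r) => M M0 chi2.
rewrite !utailN.
have -> : binE r (2^-1 - d) (fun j => (j < s)%N%:R) =
    binE r 2^-1 (fun j => tilt r d j * (j < s)%N%:R).
  by apply: eq_bigr => j _; rewrite binomial_pmf_tilt ?mulrA // -ltnS.
have quarter : (4 * M)^-1 * M = 4^-1 by field; rewrite gt_eqF.
rewrite -[X in _ <= _ + X]quarter.
rewrite -[X in _ <= _ + _ * X]chi2 -!binEZ -binED.
apply: le_binE; first by lra.
move=> j; have [js|_] := ltnP j s; first by rewrite !mulr1 le_add_sqr_divr.
by rewrite !mulr0 add0r mulr_ge0 ?sqr_ge0 // invr_ge0 mulr_ge0 // ltW.
Qed.

End binomial_expectation.

(** * Monotone convergence to the smallest root *)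

Section gap_sequence.
Context {R : realType}.
Implicit Types (q p l : R) (r s k : nat).

(** [utail r s q - 2 * q] is negative at [q = 1], so a point where it is
nonnegative forces a zero to its right. *)
Lemma utail_ge2_root r s q : (0 < s <= r)%N -> 0 < q < 1 ->
  2 * q <= utail r s q -> exists2 c, q <= c < 1 & utail r s c = 2 * c.
Proof.
move=> /andP[s0 sr] /andP[q0 q1] hq.
have cont : {within `[q, 1], continuous (fun x => utail r s x - 2 * x)}.
  apply: continuous_subspaceT => x; apply: cvgB; first exact: continuous_utail.
  by apply: cvgM; [exact: cvg_cst|exact: cvg_id].
have h1 : utail r s (1 : R) - 2 * 1 < 0 by rewrite utail_at1 //; lra.
have h0 : 0 <= utail r s q - 2 * q by rewrite subr_ge0.
have [|c /itvP cq hc] := @IVT R _ q 1 0 (ltW q1) cont.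
  by rewrite ge_min le_max (ltW h1) h0 orbT.
exists c; last by move/eqP: hc; rewrite subr_eq0 => /eqP.
rewrite !cq /= lt_neqAle cq andbT.
by apply: contraTneq h1 => c1; rewrite c1 in hc; rewrite hc ltxx.
Qed.

Lemma binB_gap r s p : (s <= r)%N -> 0 <= p <= 1 ->
  binB r s p - 2 * p + 1 = 2 * (1 - p) - utail r s (1 - p).
Proof. by move=> sr p01; rewrite binB_utail //; ring. Qed.

Lemma utail_lt_above_pstar r s q : (0 < s <= r)%N ->
  1 - pstar R r s < q <= 1 -> utail r s q < 2 * q.
Proof.
move=> sr /andP[qp q1]; have /andP[s0 sr'] := sr.
have [/andP[p0 p1] _ pmin] := @pstarP R r s sr.
have [->|qn1] := eqVneq q 1; first by rewrite utail_at1 //; lra.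
have {}q1 : q < 1 by rewrite lt_neqAle qn1.
rewrite ltNge; apply/negP => hq.
have [|c /andP[qc c1] hc] := utail_ge2_root r s q sr _ hq; first by lra.
have : pstar R r s <= 1 - c.
  apply: pmin; first by lra.
  by rewrite binB_gap //; [rewrite subKr hc subrr|lra].
lra.
Qed.

Lemma utail_pstar r s : (0 < s <= r)%N ->
  utail r s (1 - pstar R r s) = 2 * (1 - pstar R r s).
Proof.
move=> sr; have /andP[s0 sr'] := sr.
have [p01 proot _] := @pstarP R r s sr.
move: proot; rewrite binB_gap //; last by lra.
by move/eqP; rewrite subr_eq0 => /eqP.
Qed.

(** The form in which the condition [pstar = 1] is used and verified
everywhere else. *)
Lemma pstar_eq1P r s : (0 < s <= r)%N ->
  pstar R r s = 1 <-> (forall q, 0 < q < 1 -> utail r s q < 2 * q).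
Proof.
move=> sr; split=> [p1 q q01|hq].
  by apply: utail_lt_above_pstar => //; rewrite p1; lra.
have [/andP[p0 p1] _ _] := @pstarP R r s sr.
apply/eqP; rewrite eq_le p1 leNgt; apply/negP => pl1.
have /hq : 0 < 1 - pstar R r s < 1 by lra.
by rewrite utail_pstar // ltxx.
Qed.

(** In terms of [1 - pseq] the sequence decreases, and the rates of convergence
concern its distance to 0. *)
Definition qseq r s k : R := 1 - pseq R r s k.

Lemma qseq_rec r s k : (0 < s <= r)%N ->
  k.+1%:R * utail r s (qseq r s k.+1) + 2 * qseq r s k.+1 =
    k.+2%:R * utail r s (qseq r s k) /\ 0 < qseq r s k.+1 < 1.
Proof.
move=> sr; have /andP[s0 sr'] := sr.
have p01 : 0 <= pseq R r s k < 1.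
  case: k => [|k]; first by rewrite lexx ltr01.
  by have [/andP[/ltW -> ->]] := @pseqP R r s k sr.
have [pS] := @pseqP R r s k sr; rewrite /fk /qseq !binB_utail //; [|lra..].
rewrite -[k.+2%:R]natr1 => h; split; last by lra.
move: h; move: (utail _ _ _) (utail _ _ _) => a b h; lra.
Qed.

Lemma qseq0 r s : qseq r s 0 = 1.
Proof. exact: subr0. Qed.

Lemma qseq01 r s k : (0 < s <= r)%N -> 0 < qseq r s k <= 1.
Proof.
move=> sr; case: k => [|k]; first by rewrite qseq0 ltr01 lexx.
by have [_ /andP[-> /ltW]] := qseq_rec r s k sr.
Qed.

Lemma utail_lt_at r s q q' : (0 < s <= r)%N -> 0 <= q -> q < q' -> q' <= 1 ->
  utail r s q < utail r s q'.
Proof.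
move=> sr q0 qq' q'1; pose m := (q + q') / 2.
have [qm mq'] : q < m /\ m < q' by rewrite /m; split; lra.
apply: lt_le_trans (utail_strict_mono r s q m sr q0 qm _) _; first by lra.
by rewrite utail_mono //; lra.
Qed.

(** At the root [q0 = 1 - pstar] the value [q0] reproduces itself through the
recurrence since [utail r s q0 = 2 * q0]. Strict monotonicity of [utail] then
keeps the sequence above [q0]. *)
Lemma qseq_gt_pstar r s k : (0 < s <= r)%N -> 1 - pstar R r s < qseq r s k.
Proof.
move=> sr; have [/andP[p0 p1] _ _] := @pstarP R r s sr.
elim: k => [|k IH]; first by rewrite qseq0; lra.
have [rec qS] := qseq_rec r s k sr; rewrite ltNge; apply/negP => hq.
have /andP[_ qk1] := qseq01 r s k sr.
have h1 : utail r s (qseq r s k.+1) <= 2 * (1 - pstar R r s).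
  by rewrite -utail_pstar //; apply: utail_mono => //; lra.
have h2 : 2 * (1 - pstar R r s) < utail r s (qseq r s k).
  by rewrite -utail_pstar //; apply: utail_lt_at => //; lra.
have h3 : k.+1%:R * utail r s (qseq r s k.+1) <=
    k.+1%:R * (2 * (1 - pstar R r s)) by rewrite ler_wpM2l.
have h4 : k.+2%:R * (2 * (1 - pstar R r s)) <
    k.+2%:R * utail r s (qseq r s k) by rewrite ltr_pM2l.
move: h3 h4 rec; rewrite -[k.+2%:R]natr1.
move: (utail _ _ _) (utail _ _ _) => a b; lra.
Qed.

Lemma qseq_decr r s k : (0 < s <= r)%N -> qseq r s k.+1 < qseq r s k.
Proof.
move=> sr; rewrite ltNge; apply/negP => hq.
have [rec qS] := qseq_rec r s k sr.
have /andP[q0 q1] := qseq01 r s k sr.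
have h1 : utail r s (qseq r s k) <= utail r s (qseq r s k.+1).
  by apply: utail_mono => //; lra.
have h2 : utail r s (qseq r s k.+1) < 2 * qseq r s k.+1.
  by apply: utail_lt_above_pstar => //; rewrite qseq_gt_pstar //=; lra.
have h3 : k.+2%:R * utail r s (qseq r s k) <=
  k.+2%:R * utail r s (qseq r s k.+1) by rewrite ler_wpM2l.
move: h2 h3 rec; rewrite -[k.+2%:R]natr1.
move: (utail _ _ _) (utail _ _ _) => a b; lra.
Qed.

(** This identifies the limit. If [2 * l - utail] were positive at some term
of a sequence bounded below by [l], the recurrence would make
[(2 * l - utail) / k.+1] nondecreasing, hence [2 * l - utail] unbounded. *)
Lemma qseq_lb_utail r s l k : (0 < s <= r)%N -> (forall k, l <= qseq r s k) ->
  2 * l <= utail r s (qseq r s k).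
Proof.
move=> sr lq; pose d j := 2 * l - utail r s (qseq r s j).
have dS j : j.+2%:R * d j <= j.+1%:R * d j.+1.
  have [rec _] := qseq_rec r s j sr; have := lq j.+1; move: rec.
  rewrite /d -[j.+2%:R]natr1; lra.
have growth n : (n + k).+1%:R * d k <= k.+1%:R * d (n + k)%N.
  elim: n => [//|n IH].
  have h1 : (n + k).+2%:R * ((n + k).+1%:R * d k) <=
      (n + k).+2%:R * (k.+1%:R * d (n + k)%N) by rewrite ler_wpM2l.
  have h2 : k.+1%:R * ((n + k).+2%:R * d (n + k)%N) <=
      k.+1%:R * ((n + k).+1%:R * d (n + k).+1) by rewrite ler_wpM2l.
  rewrite addSn -(@ler_pM2l _ (n + k).+1%:R) //; lra.
have dle2 j : d j <= 2.
  have q01 : 0 <= qseq r s j <= 1 by have := qseq01 r s j sr; lra.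
  have := utail_ge0 r s _ q01; have := lq 0%N; rewrite qseq0 /d; lra.
rewrite -subr_le0 -/(d k) leNgt; apply/negP => dk.
have := archi_boundP (ltW (divr_gt0 (ltr0Sn R (k.*2.+1)) dk)).
set n := Num.bound _; rewrite ltr_pdivrMr // => hn.
have := growth n; rewrite leNgt => /negP; apply.
apply: (@le_lt_trans _ _ (k.*2.+2%:R)).
  rewrite -doubleS -muln2 natrM ler_wpM2l //.
apply: (lt_le_trans hn); rewrite ler_wpM2r ?(ltW dk) // ler_nat.
by rewrite leqW // leq_addr.
Qed.

Lemma qseq_cvg r s : (0 < s <= r)%N ->
  qseq r s @ \oo --> 1 - pstar R r s.
Proof.
move=> sr.
have qdec : nonincreasing_seq (qseq r s).
  by apply/nonincreasing_seqP => k; exact/ltW/qseq_decr.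
have qlb : has_lbound (range (qseq r s)).
  by exists (1 - pstar R r s) => _ [k _ <-]; exact/ltW/qseq_gt_pstar.
have qcv := nonincreasing_is_cvgn qdec qlb.
set l := limn (qseq r s).
have lq k : l <= qseq r s k by exact: nonincreasing_cvgn_ge.
have pl : 1 - pstar R r s <= l.
  by apply: limr_ge => //; apply: nearW => k; exact/ltW/qseq_gt_pstar.
suff -> : 1 - pstar R r s = l by [].
apply/eqP; rewrite eq_le pl /= leNgt; apply/negP => pl'.
have l1 : l <= 1 by rewrite -(qseq0 r s).
have : utail r s l < 2 * l by rewrite utail_lt_above_pstar // pl'.
rewrite ltNge => /negP; apply.
have : utail r s (qseq r s k) @[k --> \oo] --> utail r s l.
  exact: (cvg_comp _ _ qcv (continuous_utail r s l)).
move=> /cvgr_to_ge; apply; apply: nearW => k.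
exact: qseq_lb_utail.
Qed.

Lemma pseq_increasing_cvg r s : (0 < s <= r)%N ->
  increasing_seq (pseq R r s) /\ pseq R r s @ \oo --> pstar R r s.
Proof.
move=> sr; split.
  apply/increasing_seqP => k; have := qseq_decr r s k sr; rewrite /qseq; lra.
rewrite (_ : pseq R r s = fun k => 1 - qseq r s k); last first.
  by apply/funext => k; rewrite /qseq subKr.
rewrite -[X in _ --> X](subKr 1); apply: cvgB; first exact: cvg_cst.
exact: qseq_cvg.
Qed.

End gap_sequence.

(** * The threshold for the smallest root to be 1 *)

Section threshold.
Context {R : realType}.
Implicit Types (q p e C : R) (r s n : nat).

Lemma pstar_eq1_le r1 r2 s : (0 < s <= r1)%N -> (r1 <= r2)%N ->
  pstar R r2 s = 1 -> pstar R r1 s = 1.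
Proof.
move=> sr1 r12; have /andP[s0 sr] := sr1.
have sr2 : (0 < s <= r2)%N by rewrite s0 (leq_trans sr).
move/(pstar_eq1P r2 s sr2) => h; apply/(pstar_eq1P r1 s sr1) => q q01.
by apply: le_lt_trans (h q q01); rewrite utail_le //; lra.
Qed.

(** Once the Chebyshev bound on the lower tail falls below [1 - 2 * q], the
curve [utail] reaches the line [2 * q]. *)
Lemma pstar_neq1 r s q : (0 < s <= r)%N -> 0 < q < 1 -> s%:R < r%:R * q ->
  r%:R * q * (1 - q) <= (1 - 2 * q) * (r%:R * q - s%:R) ^+ 2 ->
  pstar R r s != 1.
Proof.
move=> sr q01 sq var; apply/eqP => /(pstar_eq1P r s sr)/(_ q q01).
apply/negP; rewrite -leNgt.
have q01' : 0 <= q <= 1 by lra.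
have := le_trans (ltail_chebyshev r s q q01' sq) var.
by rewrite ler_pM2r ?exprn_gt0 ?subr_gt0 // lerD2l lerN2.
Qed.

(** For [r] at most [C * sqrt r] above [2 * s], [utail] stays below [2 * q].
With [d] of order [1 / sqrt r], Chebyshev's inequality settles
[q <= 1/2 - d]. Between [1/2 - d] and [1/2] the line is within [2 * d] of 1,
whereas [utail] is at most its value at [1/2], which by [ltail_half_ge] is
bounded away from 1 by a constant depending only on [C]. *)
Lemma pstar_eq1_near C r s : 0 <= C -> (0 < s <= r)%N ->
  r%:R - 2 * s%:R <= C * Num.sqrt r%:R ->
  4 * (C + 1) * expR (4 * (C + 1) ^+ 2) <= Num.sqrt r%:R ->
  pstar R r s = 1.
Proof.
move=> C0 sr; have /andP[s0 sr'] := sr.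
set t := Num.sqrt r%:R; set E := expR _ => hC ht.
have E1 : 1 <= E.
  by rewrite -expR0 ler_expR mulr_ge0 // sqr_ge0.
have K1 : 1 <= C + 1 by lra.
have KE : C + 1 <= (C + 1) * E by rewrite ler_peMr //; lra.
have t0 : 0 < t by rewrite sqrtr_gt0 ltr0n (leq_trans s0).
have tt : t * t = r%:R by rewrite -expr2 sqr_sqrtr.
(* At distance [d] from 1/2 the mean is at least one unit [t] below [s]. *)
pose d : R := (C + 1) / t.
have dt : d * t = C + 1 by rewrite /d divfK // gt_eqF.
have d0 : 0 < d by rewrite /d divr_gt0 //; lra.
have d14 : d <= 4^-1.
  by rewrite -(ler_pM2r t0) dt; lra.
have cheb q : 0 <= q <= 2^-1 - d -> utail r s q <= q * (1 - q).
  move=> /andP[q0 qd].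
  have dist : t <= s%:R - r%:R * q.
    have h : r%:R * q <= r%:R * (2^-1 - d) by rewrite ler_wpM2l.
    have h' : r%:R * d = (C + 1) * t by rewrite -dt -tt; ring.
    move: h; rewrite mulrBr h'; nra.
  have q01 : 0 <= q <= 1 by lra.
  have := utail_chebyshev r s q q01.
  rewrite -subr_gt0 (lt_le_trans t0 dist) => /(_ isT) h.
  have h2 : utail r s q * r%:R <= utail r s q * (s%:R - r%:R * q) ^+ 2.
    apply: ler_wpM2l; first exact: utail_ge0.
    rewrite -[leLHS]tt -expr2 lerXn2r ?nnegrE ?(ltW t0) //.
    exact: le_trans (ltW t0) dist.
  have r0 : 0 < r%:R :> R by rewrite -tt mulr_gt0.
  rewrite -(ler_pM2l r0) [leRHS]mulrA; apply: le_trans h.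
  by rewrite mulrC.
apply/(pstar_eq1P r s sr) => q /andP[q0 q1].
have [hq|hq] := lerP (2^-1) q.
  have := utail_lt_at r s q 1 sr (ltW q0) q1 (lexx _).
  by rewrite utail_at1 //; lra.
have [hqd|hqd] := lerP q (2^-1 - d).
  have := cheb q; rewrite hqd (ltW q0) => /(_ isT); nra.
(* From here on [q] lies between [1/2 - d] and [1/2]. *)
have half : utail r s q <= utail r s 2^-1 by rewrite utail_mono //; lra.
have shift : utail r s (2^-1 - d) <= 4^-1.
  have := cheb (2^-1 - d); rewrite lexx andbT => /(_ _)/le_trans; apply; nra.
have [] : 0 <= d <= 2^-1 by lra.
move/(ltail_half_ge r s) => h.
have ME : (1 + 4 * d ^+ 2) ^+ r <= E.
  rewrite /E (_ : 4 * (C + 1) ^+ 2 = r%:R * (4 * d ^+ 2)); last first.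
    by rewrite -tt -dt; ring.
  rewrite expRM_natl lerXn2r ?nnegrE ?expR_ge0 ?expR_ge1Dx //.
  by rewrite addr_ge0 // mulr_ge0 // sqr_ge0.
have loss : 2^-1 <= E * (1 - utail r s 2^-1).
  have : 0 <= 1 - utail r s (2^-1 : R) by rewrite subr_ge0 utail_le1 //; lra.
  move/(ler_wpM2r)/(_ _ _ ME); lra.
have : 2 * d * E <= 2^-1.
  rewrite -(ler_pM2r t0); have -> : 2 * d * E * t = 2 * (d * t) * E by ring.
  by rewrite dt; lra.
nra.
Qed.

(** The disjunct [s == 0] makes the search for a least [r] total in [s]
without a separate analysis of this degenerate case. *)
Definition above_threshold r s := (s <= r)%N && ((s == 0)%N || (pstar R r s != 1)).

Lemma above_threshold_ex s : exists r, above_threshold r s.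
Proof.
case: s => [|s]; first by exists 0%N.
(* Any fixed [q < 1/2] works with [r] a large multiple of [s / q]. *)
exists (32 * s.+1)%N; rewrite /above_threshold /= leq_pmull //=.
apply: (@pstar_neq1 _ _ 4^-1); rewrite /= ?leq_pmull //; [lra| |].
  by rewrite natrM; have := ltr0Sn R s; lra.
rewrite natrM; have : 1 <= s.+1%:R :> R by rewrite ler1n.
nra.
Qed.

Definition threshold s := ex_minn (above_threshold_ex s).

Lemma thresholdP r s : (0 < s <= r)%N ->
  pstar R r s = 1 <-> (r < threshold s)%N.
Proof.
move=> /andP[s0 sr]; rewrite /threshold; case: ex_minnP => m.
rewrite /above_threshold gtn_eqF //= => /andP[sm pm] mmin; split=> [p1|rm].
  rewrite ltnNge; apply/negP => mr; move/eqP: pm; apply.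
  by apply: pstar_eq1_le p1 => //; rewrite s0.
apply/eqP; apply: contraTT rm => p1; rewrite -leqNgt; apply: mmin.
by rewrite sr.
Qed.

Lemma threshold_lower C : 0 <= C ->
  \forall s \near \oo, 2 * s%:R + C * Num.sqrt s%:R <= (threshold s)%:R :> R.
Proof.
move=> C0; near=> s.
have s0 : (0 < s)%N by near: s; exact: nbhs_infty_gt.
have hs : (4 * (C + 1) * expR (4 * (C + 1) ^+ 2)) ^+ 2 <= s%:R.
  by near: s; exact: nbhs_infty_ger.
set y := _ + _; pose r := Num.trunc y.
have y0 : 0 <= y by rewrite addr_ge0 ?mulr_ge0 ?sqrtr_ge0.
have /andP[ry yr] := truncn_itv y0; rewrite -/r in ry yr.
have sr : (s <= r)%N.
  rewrite /r truncn_ge_nat // /y.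
  by have := mulr_ge0 C0 (sqrtr_ge0 (s%:R : R)); have := ler0n R s; lra.
apply: (le_trans (ltW yr)); rewrite ler_nat; apply/thresholdP.
  by rewrite s0.
have ss : Num.sqrt s%:R <= Num.sqrt r%:R :> R by rewrite ler_wsqrtr // ler_nat.
apply: (@pstar_eq1_near C) => //; first by rewrite s0.
  by have := ler_wpM2l C0 ss; move: ry; rewrite /y; lra.
apply: le_trans ss.
have := ler_wsqrtr hs; rewrite sqrtr_sqr; apply: le_trans; exact: ler_norm.
Unshelve. all: by end_near. Qed.

(** With [r] about [(2 + e) * s] and [q = 1/2 - e/16] the mean [r * q] exceeds
[s] by a positive fraction of [s], and Chebyshev's inequality applies. *)
Lemma threshold_upper e : 0 < e <= 1 ->
  \forall s \near \oo, (threshold s)%:R <= (2 + e) * s%:R :> R.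
Proof.
move=> /andP[e0 e1]; near=> s.
have s0 : (0 < s)%N by near: s; exact: nbhs_infty_gt.
have hs1 : 2 / e <= s%:R by near: s; exact: nbhs_infty_ger.
have hs2 : 2048 / e ^+ 3 <= s%:R by near: s; exact: nbhs_infty_ger.
have s1 : 1 <= s%:R :> R by rewrite ler1n.
move: hs1 hs2; rewrite !ler_pdivrMr ?exprn_gt0 // => hs1 hs2.
set y := _ * _; pose r := Num.trunc y.
have y0 : 0 <= y by rewrite mulr_ge0 //; lra.
have /andP[ry yr] := truncn_itv y0; rewrite -/r in ry yr.
(* Rounding down costs less than [e / 2 * s] as soon as [2 <= e * s]. *)
have rlo : (2 + e / 2) * s%:R <= r%:R.
  by move: yr; rewrite -natr1 /y; lra.
have sr : (0 < s <= r)%N.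
  rewrite s0 -(ler_nat R); nra.
suff : ~~ (r < threshold s)%N.
  by rewrite -leqNgt -(ler_nat R) => /le_trans; apply.
apply/negP => /(thresholdP r s sr) p1; move/eqP: p1; apply/negP.
have dist : e / 16 * s%:R <= r%:R * (2^-1 - e / 16) - s%:R.
  have c0 : 0 <= 2^-1 - e / 16 by lra.
  rewrite lerBrDr; apply: le_trans (ler_wpM2r c0 rlo).
  rewrite -subr_ge0.
  have -> : (2 + e / 2) * s%:R * (2^-1 - e / 16) - (e / 16 * s%:R + s%:R) =
    s%:R * e * (16^-1 - e / 32) by field.
  by rewrite mulr_ge0 ?mulr_ge0 //; lra.
have es0 : 0 < e / 16 * s%:R by rewrite mulr_gt0 //; lra.
apply: (@pstar_neq1 r s (2^-1 - e / 16)) => //; [lra|lra|].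
(* The variance is at most [s], and the bound [2048 / e ^ 3] on [s] is what
   makes [s] at most [(1 - 2 * q) * (e / 16 * s) ^ 2]. *)
apply: (@le_trans _ _ s%:R).
  have -> : r%:R * (2^-1 - e / 16) * (1 - (2^-1 - e / 16)) =
    r%:R * (4^-1 - (e / 16) ^+ 2) by field.
  apply: (@le_trans _ _ (r%:R * 4^-1)); last by move: ry; rewrite /y; nra.
  by rewrite ler_wpM2l // lerBlDr lerDl sqr_ge0.
apply: (@le_trans _ _ (e / 8 * (e / 16 * s%:R) ^+ 2)).
  have -> : e / 8 * (e / 16 * s%:R) ^+ 2 = s%:R * e ^+ 3 / 2048 * s%:R by field.
  rewrite ler_peMl //; lra.
have -> : 1 - 2 * (2^-1 - e / 16) = e / 8 by field.
rewrite ler_wpM2l ?lerXn2r ?nnegrE ?(ltW es0) //; first by lra.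
exact: le_trans (ltW es0) dist.
Unshelve. all: by end_near. Qed.

Lemma threshold_sqrt_cvgy :
  (fun s : nat => ((threshold s)%:R - 2 * s%:R) / Num.sqrt s%:R : R) @ \oo
    --> +oo.
Proof.
apply/cvgryPge => A; near=> s.
have s0 : (0 < s)%N by near: s; exact: nbhs_infty_gt.
have : 2 * s%:R + `|A| * Num.sqrt s%:R <= (threshold s)%:R :> R.
  by near: s; exact: threshold_lower.
have t0 : 0 < Num.sqrt s%:R :> R by rewrite sqrtr_gt0 ltr0n.
rewrite ler_pdivlMr // => h; have := ler_norm A.
move/(ler_wpM2r (ltW t0)); lra.
Unshelve. all: by end_near. Qed.

Lemma threshold_ratio_cvg :
  (fun s : nat => (threshold s)%:R / s%:R : R) @ \oo --> (2 : R).
Proof.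
apply/cvgrPdist_le => e e0; near=> s.
have s0 : (0 < s)%N by near: s; exact: nbhs_infty_gt.
have lo : 2 * s%:R + 0 * Num.sqrt s%:R <= (threshold s)%:R :> R.
  by near: s; exact: threshold_lower.
have hi : (threshold s)%:R <= (2 + Num.min e 1) * s%:R :> R.
  by near: s; apply: threshold_upper; rewrite lt_min e0 ltr01 ge_min lexx orbT.
have s0' : 0 < s%:R :> R by rewrite ltr0n.
rewrite distrC ler_distl ler_pdivlMr // ler_pdivrMr //.
have me : Num.min e 1 <= e by rewrite ge_min lexx.
have hm := ler_wpM2r (ltW s0') me.
apply/andP; split; nra.
Unshelve. all: by end_near. Qed.

End threshold.

(** * Rates of convergence *)

Section rates.
Context {R : realType}.
Implicit Types (q e : R) (r s k n : nat).

Lemma qseq_cvg0 r s : (0 < s <= r)%N -> pstar R r s = 1 ->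
  qseq r s @ \oo --> (0 : R).
Proof. by move=> sr p1; have := @qseq_cvg R r s sr; rewrite p1 subrr. Qed.

(** For [s >= 2] and terms tending to 0, [utail] becomes negligible with
respect to [q], so that the term [2 * q] of the recurrence dominates
[4 * utail]. The resulting inequality [(k + 5) * T k.+1 <= (k + 2) * T k]
for [T k = utail r s (q k)] telescopes against [(k + 2) (k + 3) (k + 4)]. *)
Lemma qseq_quadratic_decay r s : (2 <= s <= r)%N -> pstar R r s = 1 ->
  exists2 W : R, 0 < W & \forall k \near \oo, k%:R ^+ 2 * qseq r s k <= W.
Proof.
move=> /andP[s2 sr'] p1; have s0 : (0 < s)%N by exact: ltnW.
have sr : (0 < s <= r)%N by rewrite s0.
pose u k : R := qseq r s k; pose T k : R := utail r s (u k).
have u01 k : 0 < u k <= 1 by exact: qseq01.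
have T0 k : 0 <= T k by apply: utail_ge0; have := u01 k; lra.
have rec k : k.+1%:R * T k.+1 + 2 * u k.+1 = k.+2%:R * T k.
  by have [] := @qseq_rec R r s k sr.
have [K _ hK] : \forall k \near \oo, 4 * T k <= 2 * u k.
  near=> k; have /andP[u0 u1] := u01 k.
  have uk : u k <= (2 * 2 ^+ r)^-1.
    near: k; apply: (cvgr_le 0 (qseq_cvg0 r s sr p1)).
    by rewrite invr_gt0 mulr_gt0 // exprn_gt0.
  have Tk : T k <= 2 ^+ r * u k ^+ s.
    by apply: utail_le_pow; rewrite u1 ltW.
  have us : u k ^+ s <= u k ^+ 2 by rewrite ler_wiXn2l // ltW.
  have A0 : 0 < 2 ^+ r :> R by rewrite exprn_gt0.
  move: uk; rewrite -(ler_pM2l (mulr_gt0 (ltr0Sn R 1) A0)) mulfV; last first.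
    by rewrite gt_eqF // mulr_gt0.
  move=> uk; have := ler_wpM2l (ltW A0) us.
  have := ler_wpM2r (ltW u0) uk; rewrite expr2; lra.
pose W k := k.+2%:R * k.+3%:R * k.+4%:R * T k.
have WS k : (K <= k)%N -> W k.+1 <= W k.
  move=> Kk; have := hK k.+1 (leqW Kk) => /= h4.
  have : (k.+1%:R + 4) * T k.+1 <= k.+2%:R * T k by rewrite -rec mulrDl lerD2l.
  have -> : k.+1%:R + 4 = k.+1.+4%:R :> R by rewrite -natrD addn4.
  have c0 : 0 <= k.+3%:R * k.+4%:R :> R by rewrite mulr_ge0.
  by move/(ler_wpM2l c0); rewrite /W; lra.
have WK n : W (n + K)%N <= W K.
  by elim: n => // n; apply: le_trans; apply: WS; rewrite leq_addl.
have W0 : 0 <= W K by rewrite /W !mulr_ge0.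
have decay k : (K <= k)%N -> k.+1%:R ^+ 2 * u k.+1 <= W K + 1.
  move=> Kk; have := WK (k - K)%N; rewrite subnK //; rewrite /W => h.
  have hT : 2 * u k.+1 <= k.+2%:R * T k.
    by rewrite -rec lerDr mulr_ge0.
  have c0 : 0 <= k.+3%:R * k.+4%:R :> R by rewrite mulr_ge0.
  have := ler_wpM2l c0 hT.
  have : k.+1%:R ^+ 2 * u k.+1 <= k.+3%:R * k.+4%:R * u k.+1.
    rewrite ler_wpM2r //; first by have := u01 k.+1; lra.
    by rewrite expr2; apply: ler_pM => //; rewrite ler_nat;
      do 2 apply: leqW; rewrite ?leqnSn.
  rewrite -/(u k.+1).
  have : 0 <= k.+3%:R * k.+4%:R * u k.+1 by rewrite mulr_ge0 //; have := u01 k.+1; lra.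
  move: h; lra.
exists (W K + 1); first by lra.
near=> k; have Kk : (K < k)%N by near: k; exact: nbhs_infty_gt.
by rewrite -(ltn_predK Kk); apply: decay; rewrite -ltnS (ltn_predK Kk).
Unshelve. all: by end_near. Qed.

(** Since [utail r s q <= 2 ^ r * q ^ s], the recurrence gives
[q k.+1 <= k.+2 * 2 ^ r * q k ^ s / 2]. The factor growing with [k] is
absorbed into [v], and iterating [v k.+1 <= v k ^ s] yields the claim as soon
as one [v K] is below 1. That start is what the quadratic decay provides: mere
convergence to 0 does not make [k * q k] small. *)
Lemma qseq_superexp r s : (2 <= s <= r)%N -> pstar R r s = 1 ->
  exists2 c : R, 0 < c &
    \forall k \near \oo, c * s%:R ^+ k <= - ln (qseq r s k).
Proof.
move=> s2r p1; have /andP[s2 sr'] := s2r.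
have s0 : (0 < s)%N by exact: ltnW.
have sr : (0 < s <= r)%N by rewrite s0.
pose u k : R := qseq r s k; pose A : R := 2 ^+ r.
have A1 : 1 <= A by rewrite exprn_ege1 // ler1n.
have u01 k : 0 < u k <= 1 by exact: qseq01.
pose v k := 2 * A * k.+1%:R * u k.
have c1 k : 1 <= 2 * A * k.+1%:R.
  by apply: mulr_ege1; rewrite ?ler1n //; apply: mulr_ege1; rewrite ?ler1n.
have uv k : u k <= v k.
  by rewrite /v ler_peMl //; have := u01 k; lra.
have v0 k : 0 < v k by apply: lt_le_trans (uv k); have := u01 k; lra.
have vS k : v k.+1 <= v k ^+ s.
  have [rec _] := @qseq_rec R r s k sr.
  have [u0 u1] : 0 <= u k /\ u k <= 1 by have := u01 k; split; lra.
  have hT : utail r s (u k) <= A * u k ^+ s by apply: utail_le_pow; rewrite u0.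
  have h1 : 2 * u k.+1 <= k.+2%:R * (A * u k ^+ s).
    apply: (@le_trans _ _ (k.+2%:R * utail r s (u k))).
      rewrite /u -rec lerDr mulr_ge0 // utail_ge0 //.
      by have := u01 k.+1; rewrite /u; lra.
    by rewrite ler_wpM2l.
  have -> : v k.+1 = A * k.+2%:R * (2 * u k.+1) by rewrite /v; ring.
  apply: (@le_trans _ _ (A * k.+2%:R * (k.+2%:R * (A * u k ^+ s)))).
    by rewrite ler_wpM2l // mulr_ge0 //; lra.
  rewrite /v exprMn.
  apply: (@le_trans _ _ ((2 * A * k.+1%:R) ^+ 2 * u k ^+ s)); last first.
    by rewrite ler_wpM2r ?exprn_ge0 // ler_weXn2l.
  have -> : A * k.+2%:R * (k.+2%:R * (A * u k ^+ s)) =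
    (A * k.+2%:R) ^+ 2 * u k ^+ s by ring.
  rewrite ler_wpM2r ?exprn_ge0 // lerXn2r ?nnegrE ?mulr_ge0 //; try lra.
  rewrite -[k.+2%:R]natr1; have : 1 <= k.+1%:R :> R by rewrite ler1n.
  nra.
have [K vK] : exists K, v K <= expR (- 1).
  have [W W0 hW] := qseq_quadratic_decay r s s2r p1.
  near \oo => K; exists K.
  have K0 : (0 < K)%N by near: K; exact: nbhs_infty_gt.
  have hK : K%:R ^+ 2 * u K <= W by near: K; exact: hW.
  have hK2 : 4 * A * W / expR (- 1) <= K%:R by near: K; exact: nbhs_infty_ger.
  have K1 : 1 <= K%:R :> R by rewrite ler1n.
  rewrite -(@ler_pM2l _ K%:R) ?ltr0n //.
  move: hK2; rewrite ler_pdivrMr ?expR_gt0 //; apply: le_trans.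
  apply: (@le_trans _ _ (4 * A * (K%:R ^+ 2 * u K))); last first.
    by rewrite ler_wpM2l //; lra.
  have -> : K%:R * v K = 2 * A * (K%:R * K.+1%:R) * u K by rewrite /v; ring.
  have -> : 4 * A * (K%:R ^+ 2 * u K) = 2 * A * (K%:R * (2 * K%:R)) * u K by ring.
  rewrite ler_wpM2r //; first by have := u01 K; lra.
  rewrite ler_wpM2l //; first by lra.
  by rewrite ler_wpM2l // -natr1; lra.
have vn n : v (n + K)%N <= expR (- s%:R ^+ n).
  elim: n => [//|n IH]; rewrite addSn (le_trans (vS _)) //.
  rewrite exprS -mulrN expRM_natl lerXn2r ?nnegrE ?expR_ge0 //; exact: ltW.
have s0' : 0 < s%:R :> R by rewrite ltr0n.
exists (s%:R ^+ K)^-1; first by rewrite invr_gt0 exprn_gt0.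
near=> k; have Kk : (K <= k)%N by near: k; exact: nbhs_infty_ge.
rewrite -[in leLHS](subnK Kk) exprD mulrC mulfK ?gt_eqF ?exprn_gt0 //.
rewrite lerNr -[leRHS]expRK ler_ln ?posrE ?expR_gt0 //.
  by rewrite (le_trans (uv k)) // -[k in v k](subnK Kk).
by have := u01 k; rewrite /u => /andP[].
Unshelve. all: by end_near. Qed.

(** For [s = 1] the slope of [utail] at 0 is [r], which exceeds 2 when
[r > 2]; at [q = 1/4] the case [r = 3] is already above the line. *)
Lemma pstar_s1P r : (2 <= r)%N -> pstar R r 1 = 1 <-> r = 2%N.
Proof.
move=> r2; split=> [p1|->]; last first.
  apply/(pstar_eq1P 2 1) => // q q01.
  by rewrite !utailSS !utail0S !utail0; nra.
apply/eqP; rewrite eqn_leq r2 andbT leqNgt; apply/negP => r3.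
have r1 : (0 < 1 <= r)%N by rewrite (ltnW r2).
have q01 : 0 < (4^-1 : R) < 1 by lra.
have := (pstar_eq1P r 1 r1).1 p1 4^-1 q01.
have : utail 3 1 4^-1 <= utail r 1 4^-1 :> R by apply: utail_le => //; lra.
by rewrite !utailSS !utail0S !utail0; lra.
Qed.

(** Bounds on the increments of [a - l * b] by [e] times those of [b]
telescope, and the constant of summation is negligible since [b] is
unbounded. *)
Lemma stolz_cesaro (a b : R^nat) (l : R) :
  (\forall n \near \oo, b n < b n.+1) -> b @ \oo --> +oo ->
  (fun n => (a n.+1 - a n) / (b n.+1 - b n)) @ \oo --> l ->
  (fun n => a n / b n) @ \oo --> l.
Proof.
move=> binc by_ ratio; apply/cvgrPdist_le => e e0.
have e20 : 0 < e / 2 by rewrite divr_gt0.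
have [N _ hN] : \forall n \near \oo,
    `|a n.+1 - a n - l * (b n.+1 - b n)| <= e / 2 * (b n.+1 - b n).
  near=> n; have db : 0 < b n.+1 - b n.
    by rewrite subr_gt0; near: n; exact: binc.
  have : `|l - (a n.+1 - a n) / (b n.+1 - b n)| <= e / 2.
    by near: n; exact: (cvgr_dist_le _ _ ratio).
  rewrite -(ler_pM2r db) -[X in _ * X <= _](gtr0_norm db) -normrM.
  by rewrite mulrBl divfK ?gt_eqF // distrC.
have tel n : `|a (n + N)%N - a N - l * (b (n + N)%N - b N)| <=
    e / 2 * (b (n + N)%N - b N).
  elim: n => [|n IH]; first by rewrite !subrr !mulr0 subrr normr0.
  have := hN (n + N)%N (leq_addl _ _); rewrite addSn /= => h.
  have := le_trans (ler_normD _ _) (lerD h IH).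
  by rewrite -mulrDr; congr (`|_| <= _ * _); ring.
pose C := `|a N - l * b N| + e / 2 * `|b N|.
near=> n; have Nn : (N <= n)%N by near: n; exact: nbhs_infty_ge.
have b0 : 0 < b n by near: n; move/cvgryPgt: by_; exact.
have bC : C / (e / 2) <= b n by near: n; move/cvgryPge: by_; exact.
move: bC; rewrite ler_pdivrMr // => bC.
rewrite -(ler_pM2r b0) -[X in _ * X <= _](gtr0_norm b0) -normrM.
rewrite mulrBl divfK ?gt_eqF // distrC.
have := tel (n - N)%N; rewrite subnK // => h.
have -> : a n - l * b n = (a n - a N - l * (b n - b N)) + (a N - l * b N) by ring.
apply: le_trans (ler_normD _ _) _.
have := ler_norm (- b N); rewrite normrN => hb.
have := ler_wpM2l (ltW e20) hb.
move: bC h; rewrite /C; lra.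
Unshelve. all: by end_near. Qed.

Lemma ln_succ_bounds n : (0 < n)%N ->
  n.+1%:R^-1 <= (ln n.+1%:R - ln n%:R : R) <= n%:R^-1.
Proof.
move=> n0; have n0' : 0 < n%:R :> R by rewrite ltr0n.
have ln_le (x : R) : 0 < x -> ln x <= x - 1.
  by move=> x0; have := expR_ge1Dx (ln x); rewrite lnK ?posrE //; lra.
rewrite -[X in _ <= X <= _]ln_div ?posrE //.
have div1 : n.+1%:R / n%:R = 1 + n%:R^-1 :> R.
  by rewrite -natr1 mulrDl divff ?gt_eqF // mul1r.
have div2 : n%:R / n.+1%:R = 1 - n.+1%:R^-1 :> R.
  by rewrite -[in LHS](addrK 1 n%:R) natr1 mulrBl divff ?gt_eqF // mul1r.
apply/andP; split; last first.
  by have := ln_le (n.+1%:R / n%:R); rewrite divr_gt0 // div1 => /(_ isT); lra.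
have := ln_le (n%:R / n.+1%:R); rewrite divr_gt0 // => /(_ isT).
rewrite -[n%:R / _]invf_div lnV ?posrE ?divr_gt0 // invf_div div2.
by move: n.+1%:R^-1 (ln _) => b a; lra.
Qed.

Lemma ln_nat_cvgy : (fun n => ln n%:R : R) @ \oo --> +oo.
Proof.
apply/cvgryPge => M; near=> n.
have hn : expR M <= n%:R by near: n; exact: nbhs_infty_ger.
by rewrite -(expRK M) ler_ln ?posrE ?expR_gt0 // (lt_le_trans (expR_gt0 M)).
Unshelve. all: by end_near. Qed.

(** For [r = 2] and [s = 1], [utail] is [2 * q - q ^ 2] and the linear parts of
the recurrence almost cancel. *)
Lemma qseq21_step n : let x := qseq 2 1 n : R in let y := qseq 2 1 n.+1 in
  n.+2%:R * (2 - x - y) * (x - y) = y ^+ 2.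
Proof.
move=> x y; have [] := @qseq_rec R 2 1 n isT; rewrite -/x -/y.
rewrite !utailSS !utail0S !utail0 -[n.+2%:R]natr1 => h _.
nra.
Qed.

(** Dividing [qseq21_step] by [x * y] shows that the inverses grow like half
the harmonic series. *)
Lemma qseq21_inv_step : (fun n => n.+2%:R *
    ((qseq 2 1 n.+1)^-1 - (qseq 2 1 n)^-1) : R) @ \oo --> (2^-1 : R).
Proof.
have q0 := @qseq_cvg0 2 1 isT ((pstar_s1P 2 isT).2 erefl).
apply/cvgrPdist_le => e e0; near=> n.
have x1 : qseq 2 1 n <= (4^-1 : R).
  by near: n; apply: (cvgr_le 0 q0); lra.
have xe : qseq 2 1 n <= e by near: n; exact: (cvgr_le 0 q0).
have := qseq21_step n; move: x1 xe; set x := qseq 2 1 n; set y := qseq 2 1 n.+1.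
move=> x1 xe /= step.
have /andP[x0 _] := @qseq01 R 2 1 n isT; rewrite -/x in x0.
have /andP[y0 _] := @qseq01 R 2 1 n.+1 isT; rewrite -/y in y0.
have yx : y < x := @qseq_decr R 2 1 n isT.
have xy0 : 0 < x * y by rewrite mulr_gt0.
have -> : n.+2%:R * (y^-1 - x^-1) = n.+2%:R * (x - y) / (x * y).
  by field; rewrite !gt_eqF.
set z := n.+2%:R * (x - y) in step *.
have zE : z * (2 - x - y) = y ^+ 2 by rewrite -step /z; ring.
have n1 : 1 <= n.+2%:R :> R by rewrite ler1n.
have d0 : 0 < x - y by rewrite subr_gt0.
have z0 : 0 < z by rewrite mulr_gt0.
have zxy : x - y <= z by rewrite ler_peMl // ltW.
have yy : y ^+ 2 <= x * y by rewrite expr2 ler_pM2r // ltW.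
have zy : z <= y ^+ 2 by rewrite -zE ler_peMr ?(ltW z0) //; lra.
(* [x - y <= x * y] says that [y / x] is at least [1 - y]. *)
have ylo : x * y * (1 - x) <= y ^+ 2.
  have := ler_wpM2r (ltW y0) (le_trans zxy (le_trans zy yy)); nra.
rewrite ler_distlC ler_pdivrMr // ler_pdivlMr //; apply/andP; split.
  have := ler_wpM2l (ltW xy0) xe; nra.
have d1 : 0 < 2 - 2 * x by lra.
rewrite -(ler_pM2r d1).
have h1 : z * (2 - 2 * x) <= x * y.
  apply: le_trans yy; rewrite -zE ler_wpM2l ?(ltW z0) //; lra.
apply: (le_trans h1).
have : 0 <= x * y * (2 * e * (1 - x) - x).
  rewrite mulr_ge0 ?(ltW xy0) //; nra.
lra.
Unshelve. all: by end_near. Qed.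

Lemma qseq21_asymp : (fun n => qseq 2 1 n * ln n%:R : R) @ \oo --> (2 : R).
Proof.
have dln : (fun n => n.+2%:R * (ln n.+1%:R - ln n%:R) : R) @ \oo --> (1 : R).
  apply/cvgrPdist_le => e e0; near=> n.
  have n0 : (0 < n)%N by near: n; exact: nbhs_infty_gt.
  have n0' : 0 < n%:R :> R by rewrite ltr0n.
  have : 2 / e <= n%:R by near: n; exact: nbhs_infty_ger.
  rewrite ler_pdivrMr // => ne.
  have /andP[lo hi] := ln_succ_bounds n n0.
  move: lo hi; rewrite -[n.+1%:R^-1]div1r -[n%:R^-1]div1r.
  rewrite ler_pdivrMr // ler_pdivlMr //.
  set z := ln _ - ln _; rewrite -[n.+2%:R]natr1 -[n.+1%:R]natr1 => lo hi.
  rewrite ler_distlC; apply/andP; split; first by nra.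
  by rewrite -(ler_pM2r n0'); nra.
have inv2 : (fun n => (qseq 2 1 n)^-1 / ln n%:R : R) @ \oo --> (2^-1 : R).
  apply: stolz_cesaro ln_nat_cvgy _.
    near=> n; rewrite ltr_ln ?posrE ?ltr_nat // ltr0n.
    by near: n; exact: nbhs_infty_gt.
  rewrite -[X in _ --> X]divr1.
  apply: cvg_trans (cvgM qseq21_inv_step (cvgV (oner_neq0 R) dln)).
  apply: near_eq_cvg; near=> n => /=.
  by rewrite invfM mulrACA divff ?mul1r // pnatr_eq0.
rewrite -[X in _ --> X]invrK.
rewrite (_ : (fun n => _) = fun n => ((qseq 2 1 n)^-1 / ln n%:R)^-1).
  by apply: cvgV inv2; rewrite invr_eq0.
by apply/funext => n; rewrite invfM !invrK.
Unshelve. all: by end_near. Qed.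

End rates.

Theorem theorem4 (R : realType) :
  (forall r s : nat, (1 <= s <= r)%N ->
     [/\ increasing_seq (pseq R r s),
         pseq R r s @ \oo --> pstar R r s,
         pstar R r s <= 1 &
         is_smallest_positive_root r s (pstar R r s)])
  /\
  (exists rr : nat -> nat,
     [/\ forall r s : nat, (1 <= s <= r)%N ->
           (pstar R r s = 1 <-> (r < rr s)%N),
         (fun s : nat => (rr s)%:R / s%:R : R) @ \oo --> (2 : R) &
         (fun s : nat => ((rr s)%:R - 2 * s%:R) / Num.sqrt s%:R : R) @ \oo
           --> +oo])
  /\
  (forall r s : nat, (2 <= s <= r)%N -> pstar R r s = 1 ->
     exists2 c : R, 0 < c &
       \forall k \near \oo, c * s%:R ^+ k <= - ln (1 - pseq R r s k))
  /\
  ((forall r : nat, (2 <= r)%N -> (pstar R r 1 = 1 <-> r = 2%N)) /\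
   (fun k : nat => (1 - pseq R 2 1 k) * ln k%:R) @ \oo --> (2 : R)).
Proof.
split; last split; last split.
- move=> r s sr; have [incr cv] := @pseq_increasing_cvg R r s sr.
  have root := @pstarP R r s sr.
  by split => //; have [/andP[]] := root.
- exists (@threshold R); split.
  + by move=> r s; exact: thresholdP.
  + exact: threshold_ratio_cvg.
  + exact: threshold_sqrt_cvgy.
- exact: qseq_superexp.
- by split; [exact: pstar_s1P|exact: qseq21_asymp].
Qed.
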